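(* Let $\theta\in[0,\pi)$ and let $$p(z)=a_0z^n+a_1z^{n-1}+\cdots+a_{n-1}z+a_n,\qquad a_k\in\mathbb{C},\ a_0\neq0,\ n\geq1,$$ be an arbitrary complex polynomial. Put $m=n$ if $\theta\in(0,\pi)$ and $m=n-1$ if $\theta=0$. Then the roots of $\Delta_{\theta,h}(p)$ can be labelled $\mu_1(\theta,h),\dots,\mu_m(\theta,h)$ for all $h\in\mathbb{C}$ with $|h|$ sufficiently large so that, for each $k=1,\dots,m$, $$\mu_k(\theta,h)=h\,\lambda_{k,n}(\theta)-\frac{a_1}{n\,a_0}-\frac{Q_n''(\lambda_{k,n}(\theta))}{n!\,Q_n'(\lambda_{k,n}(\theta))}\cdot\frac{p^{(n-2)}\left(-\frac{a_1}{n\,a_0}\right)}{a_0h}-\frac{Q_n'''(\lambda_{k,n}(\theta))}{n!\,Q_n'(\lambda_{k,n}(\theta))}\cdot\frac{p^{(n-3)}\left(-\frac{a_1}{n\,a_0}\right)}{a_0h^2}+O\left(\frac{1}{h^3}\right)$$ as $|h|\to\infty$.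
   Context: For $h\in\mathbb{C}\setminus\{0\}$ the operator is $$\Delta_{\theta,h}(p)(z)=\frac{e^{i\theta}p(z+ih)-e^{-i\theta}p(z-ih)}{2i}.$$ $Q_n(z)=\Delta_{\theta,1}(z^n)=\frac{e^{i\theta}(z+i)^n-e^{-i\theta}(z-i)^n}{2i}$, and $\lambda_{k,n}(\theta)$ are its roots: $\lambda_{k,n}(\theta)=\cot\frac{\pi k-\theta}{n}$, $k=1,\dots,n$, for $\theta\in(0,\pi)$, and $\lambda_{k,n}(0)=\cot\frac{\pi k}{n}$, $k=1,\dots,n-1$, for $\theta=0$. Terms containing a derivative of $p$ of negative order (which occur only for $n\le 2$ and are multiplied by a vanishing derivative of $Q_n$) are understood to be $0$. *)

(* Defs.v *)
From HB Require Import structures.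
From mathcomp Require Import all_boot all_order all_algebra.
From mathcomp Require Import complex.
From mathcomp Require Import boolp classical_sets functions filter reals.
From mathcomp Require Import topology normedtype landau trigo.

Set Implicit Arguments.
Unset Strict Implicit.
Unset Printing Implicit Defensive.

Import Order.TTheory GRing.Theory Num.Theory.
Import numFieldNormedType.Exports.

Local Open Scope classical_set_scope.
Local Open Scope ring_scope.
Local Open Scope complex_scope.

Definition cot (R : realType) (x : R) : R := cos x / sin x.

Definition expi (R : realType) (t : R) : R[i] := cos t +i* sin t.

Definition Delta (R : realType) (theta : R) (h : R[i]) (p : {poly R[i]}) :
    {poly R[i]} :=
  (2 * 'i)^-1 *: (expi theta *: (p \Po ('X + ('i * h)%:P))
                  - expi (- theta) *: (p \Po ('X - ('i * h)%:P))).

Definition Q (R : realType) (theta : R) (n : nat) : {poly R[i]} :=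
  Delta theta 1 'X^n.

Definition nroots (R : realType) (theta : R) (n : nat) : nat :=
  if theta == 0 then n.-1 else n.

(* Indexed from k = 1: the root of Q attached to i : 'I_(nroots theta n) is
   lambda theta n i.+1. *)
Definition lambda (R : realType) (theta : R) (n k : nat) : R :=
  cot ((pi * k%:R - theta) / n%:R).

(* A derivative of negative order is 0; truncated subtraction alone would
   give p itself. *)
Definition derivn_sub (R : nzRingType) (p : {poly R}) (n j : nat) : {poly R} :=
  if (j <= n)%N then p^`(n - j) else 0.

Definition cinfty (R : realType) : set_system R[i] :=
  [set A | exists r : R, forall h : R[i], r%:C < `|h| -> A h].
Arguments cinfty R : clear implicits.

#[global] Instance cinfty_filter (R : realType) : ProperFilter (cinfty R).
Proof.
apply: Build_ProperFilter.
  move=> [r /(_ ((`|r| + 1)%:C))]; apply.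
  rewrite normc_def /= expr0n addr0 sqrtr_sqr ger0_norm ?addr_ge0//.
  by rewrite ltcR ltr_pwDr// ler_norm.
split; first by exists 0.
- move=> A B [r rA] [s sB]; exists (Num.max r s) => h.
  move=> rsh; split; [apply: rA|apply: sB]; apply: le_lt_trans rsh.
    by rewrite lecR le_max lexx.
  by rewrite lecR le_max lexx orbT.
- by move=> A B AB [r rA]; exists r => h /rA /AB.
Qed.

Canonical cinfty_filterType (R : realType) :=
  FilterType (cinfty R) (@filter_filter _ _ (cinfty_filter R)).

Definition mu_expansion (R : realType) (theta : R) (p : {poly R[i]})
    (n k : nat) (h : R[i]) : R[i] :=
  let a0 := p`_n in
  let a1 := p`_n.-1 in
  let c := - (a1 / (n%:R * a0)) in
  let l := (lambda theta n k)%:C in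
  let q := Q theta n in
  h * l + c
  - q^`(2).[l] / (n`!%:R * q^`().[l])
      * ((derivn_sub p n 2).[c] / (a0 * h))
  - q^`(3).[l] / (n`!%:R * q^`().[l])
      * ((derivn_sub p n 3).[c] / (a0 * h ^+ 2)).

(* Main.v *)
(* Put [c = - a1 / (n a0)], [z = c + h w] and [e = 1 / h].  Taylor's formula
   at [c] turns [h^-n Delta theta h p] into [F_e(w) = \sum_i e^i B_i(w)] with
   [B_0 = a0 Q_n], [B_1 = 0] (by the choice of [c]) and [B_i] a multiple of
   [Q_(n-i)], hence of [Q_n^(i)].  The [lambda_k] are [nroots] distinct simple
   zeros of [Q_n], because [Q_n (cot x) = sin (theta + n x) / sin x ^ n].  At
   the truncated expansion [w_k(e)], a polynomial in [e], the residual [F_e(w_k(e))]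
   is divisible by [e^4] while [F_e'(w_k(e))] tends to [a0 Q_n'(lambda_k)].
   Instead of an implicit function theorem we use that every polynomial [P] has
   a zero within [deg P * |P(w) / P'(w)|] of [w]; this yields zeros at distance
   [O(e^4)] of the [w_k(e)].  They are distinct for small [e], so they are all
   the zeros of [F_e]. *)
Require Import Defs.
From mathcomp Require Import all_boot all_order all_algebra.
From mathcomp Require Import complex.
From mathcomp Require Import boolp classical_sets functions filter reals.
From mathcomp Require Import topology normedtype landau trigo.
From mathcomp Require Import ring.

Import Order.TTheory GRing.Theory Num.Theory.
Import numFieldNormedType.Exports.

Local Open Scope classical_set_scope.
Local Open Scope ring_scope.
Local Open Scope complex_scope.

(** * Zeros of a polynomial near a point where it is small *)

(** Induction on the factors: since [('X - y) N] has derivative [N + ('X - y) N'], the nearer to [w]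
    of [y] and the zero kept for [N] works, and the constant grows by one. Avoiding quotients covers
    [P(w) = 0] too. *)
Lemma prod_XsubC_near_root {C : numFieldType} (w z : C) (rs : seq C)
    (P := \prod_(x <- z :: rs) ('X - x%:P)) :
  exists2 x, x \in z :: rs &
    `|x - w| * `|P^`().[w]| <= (size rs).+1%:R * `|P.[w]|.
Proof.
rewrite {}/P; elim: rs => [|y rs [x xrs IH]].
  exists z; rewrite ?mem_head// big_seq1 derivXsubC hornerC normr1 mulr1 mul1r.
  by rewrite hornerXsubC distrC.
set N := \prod_(x <- _) _ in IH *.
have -> : \prod_(x <- [:: z, y & rs]) ('X - x%:P) = ('X - y%:P) * N.
  by rewrite /N !big_cons mulrCA.
have DP : `|(('X - y%:P) * N)^`().[w]| <=
    `|N.[w]| + `|y - w| * `|N^`().[w]|.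
  rewrite derivM derivXsubC mul1r hornerD hornerM hornerXsubC.
  by rewrite (le_trans (ler_normD _ _))// normrM (distrC y).
rewrite hornerM hornerXsubC normrM distrC.
have sub u : u \in [:: y; x] -> u \in [:: z, y & rs].
  rewrite !inE => /orP[->|/eqP->]; first by rewrite orbT.
  by move: xrs; rewrite inE => /orP[->//|->]; rewrite !orbT.
have rl : `|y - w| >=< `|x - w| by rewrite real_comparable// normr_real.
case/orP: rl => le.
- exists y; first by rewrite sub// mem_head.
  apply: le_trans (ler_wpM2l (normr_ge0 _) DP) _.
  rewrite mulrDr -(natr1 (size rs).+1) mulrDl mul1r addrC lerD//.
  rewrite [leRHS]mulrCA ler_wpM2l//; apply: le_trans IH.
  by rewrite ler_wpM2r.
- exists x; first by rewrite sub// !inE eqxx orbT.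
  apply: le_trans (ler_wpM2l (normr_ge0 _) DP) _.
  rewrite mulrDr -(natr1 (size rs).+1) mulrDl mul1r addrC lerD//.
    by rewrite mulrCA [leRHS]mulrCA ler_wpM2l.
  by rewrite ler_wpM2r.
Qed.

(* From [P'/P = \sum_z 1 / (w - z)]: the root nearest to [w] contributes at
   least [|P'(w)/P(w)| / deg P] in modulus. *)
Lemma poly_near_root {C : numClosedFieldType} (P : {poly C}) (w : C) :
  P^`().[w] != 0 ->
  exists2 x, root P x & `|x - w| * `|P^`().[w]| <= (size P)%:R * `|P.[w]|.
Proof.
move=> dP; have P0 : P != 0.
  by apply: contraNneq dP => ->; rewrite deriv0 horner0.
have [rs PE] := closed_field_poly_normal P.
case: rs PE => [|z rs] PE.
  by rewrite PE big_nil -mul_polyC mulr1 derivC horner0 eqxx in dP.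
have [x xrs le] := prod_XsubC_near_root w z rs.
have rPx : root P x.
  by rewrite PE rootZ ?lead_coef_eq0// root_prod_XsubC.
have -> : size P = (size rs).+2.
  by rewrite PE size_scale ?lead_coef_eq0// size_prod_XsubC.
exists x => //; rewrite PE derivZ !hornerZ !normrM !(mulrCA _ `|lead_coef _|).
rewrite ler_wpM2l//; apply: le_trans le _.
by rewrite ler_wpM2r// ler_nat.
Qed.

(** * Perturbation of a simple zero in a polynomial family *)

Lemma horner_bounded {C : numDomainType} (P : {poly C}) :
  exists2 M : C, 0 <= M & forall e, `|e| <= 1 -> `|P.[e]| <= M.
Proof.
exists (\sum_(i < size P) `|P`_i|); first exact: sumr_ge0.
move=> e e1; rewrite horner_coef; apply: le_trans (ler_norm_sum _ _ _) _.
apply: ler_sum => i _; rewrite normrM normrX ler_piMr// exprn_ile1//.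
Qed.

(** Remainders are kept as polynomials, so that orders of smallness in [e] become divisibility by
    powers of ['X]. *)
Lemma comp_poly_taylor1 {C : comNzRingType} (q x : {poly C}) (l : C) :
  exists r, q \Po (l%:P + x) = q.[l]%:P + x * r.
Proof.
have /factor_theorem[r qr] : root (q - q.[l]%:P) l.
  by rewrite rootE hornerD hornerN hornerC subrr.
exists (r \Po (l%:P + x)).
rewrite -[q in LHS](subrK q.[l]%:P) qr comp_polyD comp_polyM comp_polyC.
by rewrite comp_polyB comp_polyC comp_polyX addrAC subrr add0r addrC mulrC.
Qed.

Lemma comp_poly_taylor2 {C : comNzRingType} (q x : {poly C}) (l : C) :
  exists r, q \Po (l%:P + x) = q.[l]%:P + q^`().[l] *: x + x ^+ 2 * r.
Proof.
have /factor_theorem[r qr] : root (q - q.[l]%:P) l.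
  by rewrite rootE hornerD hornerN hornerC subrr.
have [s rs] := comp_poly_taylor1 r x l.
have -> : q^`().[l] = r.[l].
  have := congr1 (fun u => u^`().[l]) qr.
  rewrite derivB derivC subr0 derivM hornerD !hornerM derivXsubC hornerXsubC.
  by rewrite subrr mulr0 add0r hornerC mulr1.
exists s.
rewrite -[q in LHS](subrK q.[l]%:P) qr comp_polyD comp_polyM comp_polyC rs.
rewrite comp_polyB comp_polyC comp_polyX -mul_polyC; ring.
Qed.

Lemma horner_family {C : comNzRingType} (B : nat -> {poly C}) (N : nat)
    (W : {poly C}) (e : C) :
  (\sum_(i < N) e ^+ i *: B i).[W.[e]] =
  (\sum_(i < N) 'X^i * (B i \Po W)).[e].
Proof.
rewrite !horner_sum; apply: eq_bigr => i _.
by rewrite hornerZ hornerM hornerXn horner_comp.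
Qed.

(** [V] solves the linearized equation: [d 'X^2 V] cancels ['X^2 B_2(l) + 'X^3 B_3(l)]. The
    quadratic term of [B_0], the Taylor remainders of [B_2] and [B_3], and the terms with [i >= 4]
    all have order at least four. *)
Lemma family_residual {C : fieldType} (B : nat -> {poly C}) (N : nat) (l : C)
    (d := (B 0%N)^`().[l])
    (V := - (((B 2).[l] / d)%:P + ((B 3).[l] / d) *: 'X)) :
  root (B 0%N) l -> d != 0 -> B 1%N = 0 ->
  exists H, \sum_(i < N.+4) 'X^i * (B i \Po (l%:P + 'X^2 * V)) = 'X^4 * H.
Proof.
move=> /rootP B0 d0 B1.
have [r0 E0] := comp_poly_taylor2 (B 0%N) ('X^2 * V) l.
have [r2 E2] := comp_poly_taylor1 (B 2) ('X^2 * V) l.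
have [r3 E3] := comp_poly_taylor1 (B 3) ('X^2 * V) l.
rewrite (@big_split_ord _ _ _ 4 N) /=.
under [X in _ + X]eq_bigr do rewrite exprD -mulrA.
rewrite -mulr_sumr; set T := \sum_(i < N) _.
rewrite !big_ord_recl big_ord0 /= /bump /= !add1n.
exists (V ^+ 2 * r0 + V * r2 + 'X * V * r3 + T).
rewrite E0 E2 E3 B1 comp_poly0 B0 -/d.
have -> : d *: ('X^2 * V) = - 'X^2 * ((B 2).[l]%:P + 'X * (B 3).[l]%:P).
  rewrite /V -!mul_polyC mulrN mulrN mulrCA mulNr; congr (- (_ * _)).
  rewrite mulrDr mulrA -!polyCM !(mulrC d) !divfK//.
  by rewrite mulrC.
by ring.
Qed.

Lemma family_derivative {C : comNzRingType} (B : nat -> {poly C}) (N : nat)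
    (l : C) (V : {poly C}) :
  exists K, \sum_(i < N.+1) 'X^i * ((B i)^`() \Po (l%:P + 'X^2 * V)) =
    ((B 0%N)^`().[l])%:P + 'X * K.
Proof.
have [r E] := comp_poly_taylor1 (B 0%N)^`() ('X^2 * V) l.
rewrite big_ord_recl E.
under eq_bigr do rewrite lift0 exprS -mulrA.
rewrite -mulr_sumr; set T := \sum_(i < N) _.
by exists ('X * V * r + T); ring.
Qed.

Lemma perturbed_root {C : numClosedFieldType} (B : nat -> {poly C}) (N : nat)
    (l : C) (d := (B 0%N)^`().[l]) :
  root (B 0%N) l -> d != 0 -> B 1%N = 0 ->
  exists (x : C -> C) (M r : C), [/\ 0 <= M, 0 < r & forall e, `|e| <= r ->
    [/\ root (\sum_(i < N.+4) e ^+ i *: B i) (x e),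
        `|x e - (l - e ^+ 2 * ((B 2).[l] / d) - e ^+ 3 * ((B 3).[l] / d))|
          <= M * `|e| ^+ 4
      & `|x e - l| <= M * `|e|]].
Proof.
move=> B0 d0 B1.
pose F e := \sum_(i < N.+4) e ^+ i *: B i.
pose V := - (((B 2).[l] / d)%:P + ((B 3).[l] / d) *: 'X).
pose W := l%:P + 'X^2 * V.
have [H HE] := family_residual B N l B0 d0 B1; rewrite -/d -/V -/W in HE.
have [K KE] := family_derivative B N.+3 l V; rewrite -/d -/W in KE.
have FW e : (F e).[W.[e]] = e ^+ 4 * H.[e].
  by rewrite /F horner_family HE hornerM hornerXn.
have DFW e : (F e)^`().[W.[e]] = d + e * K.[e].
  rewrite /F raddf_sum /=; under eq_bigr do rewrite derivZ.
  rewrite (horner_family (fun i => (B i)^`())) KE.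
  by rewrite hornerD hornerM hornerC hornerX.
have WE e : W.[e] =
    l - e ^+ 2 * ((B 2).[l] / d) - e ^+ 3 * ((B 3).[l] / d).
  have -> : W.[e] = l + e ^+ 2 * - ((B 2).[l] / d + (B 3).[l] / d * e).
    by rewrite /W /V !hornerE.
  by ring.
have [MH MH0 HM] := horner_bounded H.
have [MK MK0 KM] := horner_bounded K.
have [MV MV0 VM] := horner_bounded V.
(* The bound of [poly_near_root] contains the size of [F e], which must be controlled uniformly in
   [e]. *)
pose S := (\max_(i < N.+4) size (B i))%N.
have FS e : (size (F e) <= S)%N.
  apply: leq_trans (size_sum _ _ _) _; apply/bigmax_leqP => i _.
  by apply: leq_trans (size_scale_leq _ _) _; apply: leq_bigmax.
have nd0 : 0 < `|d| by rewrite normr_gt0.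
(* From [poly_near_root] with [|F'| >= |d| / 2] and [|F| <= MH |e|^4]. *)
pose M := S%:R * MH * 2 / `|d|.
have M0 : 0 <= M by rewrite /M !mulr_ge0 ?invr_ge0// ?ler0n.
have k0 : 0 < 1 + 2 * MK / `|d|.
  by rewrite ltr_pwDl ?ltr01// !mulr_ge0 ?invr_ge0// ?ler0n.
(* With this radius [|e| <= 1], where the bounds of [horner_bounded] apply, and [|e| MK <= |d| / 2],
   which keeps the derivative away from 0. *)
pose r := (1 + 2 * MK / `|d|)^-1.
have r1 : r <= 1.
  by rewrite invf_le1// lerDl !mulr_ge0 ?invr_ge0// ?ler0n.
have near_root e : `|e| <= r ->
    exists x, root (F e) x /\ `|x - W.[e]| <= M * `|e| ^+ 4.
  move=> er.
  have e1 := le_trans er r1.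
  have eK : `|e| * MK <= `|d| / 2.
    have := er; rewrite -[leRHS]mul1r ler_pdivlMr// mulrDr mulr1 => le1.
    have : `|e| * (2 * MK / `|d|) <= 1.
      by apply: le_trans le1; rewrite lerDr.
    by rewrite !mulrA ler_pdivrMr// mul1r ler_pdivlMr ?ltr0n// mulrAC.
  have DF : `|d| / 2 <= `|(F e)^`().[W.[e]]|.
    rewrite DFW; apply: le_trans (lerB_normD _ _).
    rewrite lerBrDr -lerBrDl; have -> : `|d| - `|d| / 2 = `|d| / 2 by field.
    rewrite normrM; apply: le_trans eK; apply: ler_wpM2l => //; exact: KM.
  have dh0 : 0 < `|d| / 2 by rewrite divr_gt0// ltr0n.
  have DF0 : (F e)^`().[W.[e]] != 0.
    by rewrite -normr_gt0 (lt_le_trans dh0 DF).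
  have [x rx xle] := poly_near_root (F e) W.[e] DF0.
  exists x; split=> //.
  suff : `|x - W.[e]| * (`|d| / 2) <= S%:R * (`|e| ^+ 4 * MH).
    rewrite -ler_pdivlMr// => /le_trans-> //.
    by rewrite /M invf_div le_eqVlt; apply/orP; left; apply/eqP; ring.
  apply: (le_trans (ler_wpM2l (normr_ge0 _) DF)); apply: (le_trans xle).
  rewrite FW normrM normrX ler_pM ?mulr_ge0 ?exprn_ge0 ?ler0n//.
    by rewrite ler_nat.
  by rewrite ler_wpM2l ?exprn_ge0// HM.
(* If no such zero exists, which can happen only for [|e| > r], the value is the default 0. *)
pose x e := xget 0 [set x | root (F e) x /\ `|x - W.[e]| <= M * `|e| ^+ 4].
(* [MV] pays for [|W(e) - l| = |e^2 V(e)| <= MV |e|]. *)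
exists x, (M + MV), r; split; [exact: addr_ge0|by rewrite invr_gt0|] => e er.
have [rx xle] : root (F e) (x e) /\ `|x e - W.[e]| <= M * `|e| ^+ 4.
  exact: (xgetPex 0 (near_root e er)).
split=> //.
  by rewrite -WE (le_trans xle)// ler_wpM2r ?exprn_ge0// lerDl.
rewrite -(subrK W.[e] (x e)) -addrA (le_trans (ler_normD _ _))// mulrDl lerD//.
  rewrite (le_trans xle)// ler_wpM2l// exprS ler_piMr// exprn_ile1//.
  exact: le_trans er r1.
rewrite /W hornerD hornerC addrC addKr hornerM hornerXn normrM normrX expr2.
by rewrite mulrC ler_pM ?mulr_ge0 ?VM ?(le_trans er)// ler_piMr// (le_trans er).
Qed.

(** * Values of [Q] at cotangents *)

Lemma expiD {R : realType} (a b : R) : expi (a + b) = expi a * expi b.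
Proof. by rewrite /expi cosD sinD; simpc; rewrite (addrC (sin a * _)). Qed.

Lemma expi_natmul {R : realType} (a : R) (n : nat) :
  expi (n%:R * a) = expi a ^+ n.
Proof.
elim: n => [|n IH]; first by rewrite mul0r /expi cos0 sin0.
by rewrite -natr1 mulrDl mul1r expiD IH exprSr.
Qed.

Lemma expiBN {R : realType} (a : R) :
  expi a - expi (- a) = (2 * 'i) * (sin a)%:C.
Proof.
rewrite /expi cosN sinN; apply/eqP; rewrite eq_complex /=.
by apply/andP; split; apply/eqP; ring.
Qed.

Lemma mul2i_neq0 {R : rcfType} : (2 * 'i : R[i]) != 0.
Proof. by rewrite mulf_neq0 ?pnatr_eq0// eq_complex /= oner_eq0 andbF. Qed.

Lemma cotDi {R : realType} (x : R) : sin x != 0 ->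
  (cot x)%:C + 'i = expi x / (sin x)%:C.
Proof.
move=> s0; have s0' : (sin x)%:C != 0 by rewrite eq_complex /= eqxx andbT.
apply: (mulIf s0'); rewrite divfK// mulrDl -rmorphM /= /cot divfK//.
by rewrite /expi; simpc.
Qed.

Lemma cotBi {R : realType} (x : R) : sin x != 0 ->
  (cot x)%:C - 'i = expi (- x) / (sin x)%:C.
Proof.
move=> s0; have s0' : (sin x)%:C != 0 by rewrite eq_complex /= eqxx andbT.
apply: (mulIf s0'); rewrite divfK// mulrBl -rmorphM /= /cot divfK//.
by rewrite /expi cosN sinN; simpc.
Qed.

Lemma horner_Delta {R : realType} (theta : R) (h : R[i]) (p : {poly R[i]}) z :
  (Delta theta h p).[z] = (2 * 'i)^-1 *
    (expi theta * p.[z + 'i * h] - expi (- theta) * p.[z - 'i * h]).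
Proof.
rewrite /Delta hornerZ hornerD hornerN !hornerZ !horner_comp.
by rewrite hornerD hornerX hornerC hornerD hornerN hornerX hornerC.
Qed.

(** By [cotDi] and [cotBi], taking n-th powers multiplies the angle by [n], and the two exponentials
    recombine into a sine. *)
Lemma horner_Q_cot {R : realType} (theta x : R) (n : nat) : sin x != 0 ->
  (Q theta n).[(cot x)%:C] = (sin (theta + n%:R * x) / sin x ^+ n)%:C.
Proof.
move=> s0; rewrite horner_Delta !hornerXn mulr1 cotDi// cotBi//.
rewrite !expr_div_n -!expi_natmul !mulrA -mulrBl -!expiD mulrN -opprD expiBN.
by rewrite mulrA mulKf ?mul2i_neq0// rmorphM /= fmorphV /= rmorphXn.
Qed.

(** * Differentiation and Taylor expansion of [Delta] *)

Lemma deriv_Delta {R : realType} (theta : R) (h : R[i]) (p : {poly R[i]}) :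
  (Delta theta h p)^`() = Delta theta h p^`().
Proof.
rewrite /Delta derivZ derivB !derivZ !deriv_comp !derivE.
by rewrite addr0 !mulr1.
Qed.

(** [Delta] commutes with differentiation, so the [Q theta n] form an Appell sequence; this trades
    the derivatives of [Q] in the expansion for [Q] of lower index. *)
Lemma deriv_Q {R : realType} (theta : R) (n : nat) :
  (Q theta n.+1)^`() = Q theta n *+ n.+1.
Proof.
rewrite /Q deriv_Delta derivXn -scaler_nat -[RHS]scaler_nat /Delta !comp_polyZ.
rewrite [RHS]scalerA (mulrC n.+1%:R) -[RHS]scalerA; congr (_ *: _).
by rewrite scalerBr !scalerA !(mulrC n.+1%:R).
Qed.

Lemma derivn_Q {R : realType} (theta : R) (n i : nat) : (i <= n)%N ->
  (Q theta n)^`(i) = Q theta (n - i) *+ n ^_ i.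
Proof.
elim: i n => [|i IH] [|n]// le; rewrite ?ffactn0 ?subn0 ?derivn0//.
by rewrite derivSn deriv_Q derivnMn IH// subSS ffactSS mulnC mulrnA.
Qed.

Lemma comp_poly_taylor {C : comNzRingType} (p q : {poly C}) (c : C) (n : nat) :
  (size p <= n)%N ->
  p \Po (c%:P + q) = \sum_(j < n) p^`N(j).[c] *: q ^+ j.
Proof.
move=> pn; rewrite /comp_poly (nderiv_taylor_wide (n := n)); last first.
- by rewrite size_map_polyC.
- exact: mulrC.
by apply: eq_bigr => j _; rewrite nderivn_map horner_map mul_polyC.
Qed.

(** With [z = c + h w] the arguments [z +- 'i h] become [c + h (w +- 'i)]; after expanding both at
    [c], the powers [(w +- 'i)^j] recombine into [Q theta j]. *)
Lemma Delta_shift {R : realType} (theta : R) (h c : R[i]) (p : {poly R[i]})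
    (n : nat) : (size p <= n)%N ->
  Delta theta h p \Po (c%:P + h *: 'X) =
  \sum_(j < n) (h ^+ j * p^`N(j).[c]) *: Q theta j.
Proof.
move=> pn; rewrite /Delta comp_polyZ comp_polyB !comp_polyZ -!comp_polyA.
rewrite comp_polyD comp_polyB !comp_polyX !comp_polyC.
have -> : c%:P + h *: 'X + ('i * h)%:P = c%:P + h *: ('X + 'i%:P).
  by rewrite -addrA scalerDr -!mul_polyC -polyCM (mulrC h).
have -> : c%:P + h *: 'X - ('i * h)%:P = c%:P + h *: ('X - 'i%:P).
  by rewrite -addrA scalerBr -!mul_polyC -polyCM (mulrC h).
rewrite !(comp_poly_taylor _ _ _ n pn) !scaler_sumr -sumrB scaler_sumr.
apply: eq_bigr => j _.
rewrite /Q /Delta !comp_Xn_poly mulr1 !exprZn !scalerA -!mul_polyC.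
by rewrite !polyCM; ring.
Qed.

(** * Degree and zeros of [Q] *)

Lemma size_Q_le {R : realType} (theta : R) (n : nat) :
  (size (Q theta n) <= n.+1)%N.
Proof.
have XD (c : R[i]) : size (('X + c%:P) ^+ n) = n.+1.
  by rewrite -(opprK c) polyCN size_exp_XsubC.
rewrite /Q /Delta (leq_trans (size_scale_leq _ _))// !comp_Xn_poly.
rewrite (leq_trans (size_polyD _ _))// geq_max size_polyN.
by rewrite -polyCN !(leq_trans (size_scale_leq _ _)) ?XD.
Qed.

(** This coefficient vanishes at [theta = 0], where the degree drops; hence the case distinction in
    [nroots]. *)
Lemma coef_Q {R : realType} (theta : R) (n : nat) :
  (Q theta n)`_n = (sin theta)%:C.
Proof.
have XD (c : R[i]) : (('X + c%:P) ^+ n)`_n = 1.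
  have := monic_exp n (monicXaddC c); rewrite monicE lead_coefE.
  by rewrite -(opprK c) polyCN size_exp_XsubC /= => /eqP.
rewrite /Q /Delta !comp_Xn_poly coefZ coefB !coefZ -polyCN !XD !mulr1 expiBN.
by rewrite mulKf// mul2i_neq0.
Qed.

Lemma sin_natpi {R : realType} (k : nat) : sin (pi * k%:R : R) = 0.
Proof.
elim: k => [|k IH]; first by rewrite mulr0 sin0.
by rewrite -natr1 mulrDr mulr1 sinDpi IH oppr0.
Qed.

Lemma sin_natpiB_neq0 {R : realType} (k : nat) (x : R) :
  sin x != 0 -> sin (pi * k%:R - x) != 0.
Proof.
move=> s0; rewrite sinB sin_natpi mul0r sub0r oppr_eq0 mulf_neq0//.
apply/eqP => c0; have := cos2Dsin2 (pi * k%:R : R).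
by rewrite sin_natpi c0 expr0n addr0 => /eqP; rewrite eq_sym oner_eq0.
Qed.

(** For [x <= y], equal cotangents give [sin (y - x) = 0] with [y - x] in [[0, pi)]. *)
Lemma cot_inj {R : realType} (x y : R) :
  0 < x < pi -> 0 < y < pi -> cot x = cot y -> x = y.
Proof.
wlog le_xy : x y / x <= y.
  by case: (leP x y) => [xy|/ltW yx] H hx hy E; [|symmetry]; apply: H.
move=> hx hy E; have sx := sin_gt0_pi hx; have sy := sin_gt0_pi hy.
have s0 : sin (y - x) = 0.
  move: E => /eqP; rewrite /cot eqr_div ?(gt_eqF sx) ?(gt_eqF sy)// => /eqP E.
  by rewrite sinB (mulrC (sin y)) E subrr.
apply/eqP; rewrite eq_le le_xy /= leNgt; apply/negP => lt_xy.
suff : 0 < sin (y - x) by rewrite s0 ltxx.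
apply: sin_gt0_pi; rewrite subr_gt0 lt_xy /=.
by move: hx hy => /andP[x0 _] /andP[_ ypi]; rewrite ltrBlDr ltr_pwDr ?ltW.
Qed.

Lemma ltn_nroots {R : realType} (theta : R) (n i : nat) :
  (i < nroots theta n)%N -> (0 < n)%N.
Proof. by rewrite /nroots; case: ifP; case: n. Qed.

(** On this interval [sin] is positive and [cot] injective. The index [i.+1 = n] occurs only for
    [theta > 0]; at [theta = 0] its angle would be [pi]. *)
Lemma lambda_angle {R : realType} (theta : R) (n i : nat) :
  0 <= theta < pi -> (i < nroots theta n)%N ->
  0 < (pi * i.+1%:R - theta) / n%:R < pi.
Proof.
move=> /andP[t0 tpi] lti.
have n0 : 0 < n%:R :> R by rewrite ltr0n (ltn_nroots _ _ _ lti).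
apply/andP; split.
  rewrite divr_gt0// subr_gt0 (lt_le_trans tpi)// ler_peMr ?pi_ge0//.
  by rewrite ler1n.
rewrite ltr_pdivrMr// ltrBlDr.
move: lti; rewrite /nroots; case: eqP => [->|/eqP t0' lti].
  rewrite addr0 => lti; rewrite ltr_pM2l ?pi_gt0// ltr_nat.
  by rewrite -ltn_predRL.
rewrite ltr_pwDr ?lt_def ?t0' ?t0// ler_wpM2l ?pi_ge0// ler_nat//.
Qed.

Lemma root_Q_lambda {R : realType} (theta : R) (n i : nat) :
  0 <= theta < pi -> (i < nroots theta n)%N ->
  root (Q theta n) (lambda theta n i.+1)%:C.
Proof.
move=> ht hi; have /sin_gt0_pi s0 := lambda_angle theta n i ht hi.
have n0 : n%:R != 0 :> R.
  by rewrite pnatr_eq0 -lt0n (ltn_nroots _ _ _ hi).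
rewrite rootE /lambda (horner_Q_cot _ _ _ (lt0r_neq0 s0)).
rewrite (mulrC n%:R) divfK// addrC subrK.
by rewrite sin_natpi mul0r.
Qed.

Lemma deriv_Q_lambda_neq0 {R : realType} (theta : R) (n i : nat) :
  0 <= theta < pi -> (i < nroots theta n)%N ->
  (Q theta n)^`().[(lambda theta n i.+1)%:C] != 0.
Proof.
case: n => [|n] ht hi; first by move: hi; rewrite /nroots; case: ifP.
have /sin_gt0_pi s0 := lambda_angle theta n.+1 i ht hi.
have n0 : n.+1%:R != 0 :> R by rewrite pnatr_eq0.
rewrite deriv_Q hornerMn mulrn_eq0 /=.
rewrite /lambda (horner_Q_cot _ _ _ (lt0r_neq0 s0)).
set x := _ / _ in s0 *.
(* With the index lowered by one, the angle misses a multiple of [pi] by exactly [x], so its sine is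
   [+- sin x], which is nonzero. *)
have -> : theta + n%:R * x = pi * i.+1%:R - x.
  rewrite -[RHS]addr0 -(subrr theta) /x; apply: (mulIf n0).
  by rewrite -natr1 in n0 *; field.
rewrite eq_complex /= eqxx andbT.
rewrite mulf_neq0 ?invr_eq0 ?expf_neq0 ?(lt0r_neq0 s0)//.
by rewrite sin_natpiB_neq0 ?(lt0r_neq0 s0).
Qed.

Lemma lambda_inj {R : realType} (theta : R) (n i j : nat) :
  0 <= theta < pi -> (i < nroots theta n)%N -> (j < nroots theta n)%N ->
  lambda theta n i.+1 = lambda theta n j.+1 -> i = j.
Proof.
move=> ht hi hj /cot_inj E.
have n0 : n%:R != 0 :> R.
  by rewrite pnatr_eq0 -lt0n (ltn_nroots _ _ _ hi).
have := E (lambda_angle _ _ _ ht hi) (lambda_angle _ _ _ ht hj).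
move=> /(mulIf (invr_neq0 n0))/addIr/mulfI.
by rewrite gt_eqF ?pi_gt0// => /(_ isT)/eqP; rewrite eqr_nat eqSS => /eqP.
Qed.

Lemma expi_neq0 {R : realType} (a : R) : expi a != 0.
Proof.
suff : expi a * expi (- a) != 0 by rewrite mulf_eq0 negb_or => /andP[].
by rewrite -expiD subrr /expi cos0 sin0 oner_neq0.
Qed.

Lemma Q_neq0 {R : realType} (theta : R) (n : nat) : (0 < n)%N ->
  Q theta n != 0.
Proof.
move=> n0; apply/eqP => Q0.
(* At ['i] the second power vanishes, since [n > 0], and the first is [(2 'i)^n]. *)
have := horner_Delta theta 1 'X^n 'i; rewrite -/(Q theta n) Q0 horner0.
rewrite !hornerXn mulr1 subrr expr0n gtn_eqF// mulr0 subr0 => /esym/eqP.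
apply/negP; rewrite !mulf_neq0 ?invr_eq0 ?mul2i_neq0 ?expi_neq0 ?expf_neq0//.
by rewrite -mulr2n -mulr_natl mul2i_neq0.
Qed.

(** Bounded above through the leading coefficient, below by the distinct zeros [lambda]. *)
Lemma size_Q {R : realType} (theta : R) (n : nat) :
  0 <= theta < pi -> (0 < n)%N -> size (Q theta n) = (nroots theta n).+1.
Proof.
move=> ht n0; apply/eqP; rewrite eqn_leq; apply/andP; split.
  have := size_Q_le theta n; rewrite /nroots; case: eqP => // t0.
  rewrite leq_eqVlt => /predU1P[sz|]; last by rewrite ltnS prednK.
  have := lead_coefE (Q theta n); rewrite sz /= coef_Q {2}t0 sin0 => /eqP.
  by rewrite lead_coef_eq0 -size_poly_eq0 sz.
rewrite -[X in (X < _)%N](size_enum_ord (nroots theta n)).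
rewrite -(size_map (fun i : 'I_(nroots theta n) => (lambda theta n i.+1)%:C)).
apply: max_poly_roots; first exact: Q_neq0.
- by apply/allP => _ /mapP[i _ ->]; apply: root_Q_lambda.
- rewrite map_inj_uniq ?enum_uniq// => i j [] E.
  apply: val_inj.
  exact: (lambda_inj theta n _ _ ht (ltn_ord i) (ltn_ord j) E).
Qed.

(** * The family in [1 / h] attached to [Delta] *)

(* After [z = c + h w] and division by [h ^ n], [Delta theta h p] becomes
   [\sum_(i <= n) h^-i *: shift_family i]. *)
Definition shift_family {R : realType} (theta : R) (p : {poly R[i]}) (n : nat)
    (c : R[i]) (i : nat) : {poly R[i]} :=
  if (i <= n)%N then p^`N(n - i).[c] *: Q theta (n - i) else 0.

(** For [p] of degree [n >= 1], the centroid of its zeros, which is the zero of its derivative of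
    order [n - 1]. *)
Definition center {R : realType} (p : {poly R[i]}) (n : nat) : R[i] :=
  - (p`_n.-1 / (n%:R * p`_n)).

Lemma Delta_family {R : realType} (theta : R) (h c : R[i]) (p : {poly R[i]})
    (n : nat) : h != 0 -> (size p <= n.+1)%N ->
  Delta theta h p \Po (c%:P + h *: 'X) =
  h ^+ n *: \sum_(i < n.+4) h^-1 ^+ i *: shift_family theta p n c i.
Proof.
move=> h0 pn; rewrite (Delta_shift _ _ _ _ n.+1)//.
(* The three indices beyond [n] contribute 0; they give the sum the shape [N.+4] of [perturbed_root]
   even for small [n]. *)
rewrite -(addn3 n.+1) big_split_ord /= [X in _ + X]big1 ?addr0; last first.
  by move=> i _; rewrite /shift_family leqNgt addSn ltnS leq_addr scaler0.
(* Reversing the sum lets [h^(n - i)] be read as [h^n h^-i]. *)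
rewrite scaler_sumr (reindex_inj rev_ord_inj); apply: eq_bigr => i _ /=.
have le_in : (i <= n)%N by rewrite -ltnS.
rewrite /shift_family le_in subSS !scalerA exprVn -[in h ^+ n](subnK le_in).
by rewrite exprD mulfK// expf_neq0.
Qed.

Lemma shift_family0 {R : realType} (theta : R) (p : {poly R[i]}) (n : nat) c :
  (size p <= n.+1)%N -> shift_family theta p n c 0 = p`_n *: Q theta n.
Proof.
move=> pn; rewrite /shift_family subn0; congr (_ *: _).
have -> : p^`N(n) = (p`_n)%:P; last by rewrite hornerC.
apply/polyP => i; rewrite coef_nderivn coefC; case: i => [|i].
  by rewrite addn0 binn.
by rewrite nth_default ?mul0rn// (leq_trans pn)// addnS ltnS leq_addr.
Qed.

Lemma coef_size_neq0 {C : nzSemiRingType} (p : {poly C}) (n : nat) :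
  size p = n.+1 -> p`_n != 0.
Proof.
move=> pn; have := lead_coefE p; rewrite pn /= => <-.
by rewrite lead_coef_eq0 -size_poly_eq0 pn.
Qed.

Lemma shift_family1 {R : realType} (theta : R) (p : {poly R[i]}) (n : nat) :
  (0 < n)%N -> size p = n.+1 -> shift_family theta p n (center p n) 1 = 0.
Proof.
move=> n0 pn; rewrite /shift_family n0 subn1.
have -> : p^`N(n.-1) = (p`_n.-1)%:P + (p`_n *+ n) *: 'X.
  apply/polyP => i; rewrite coef_nderivn coefD coefC coefZ coefX.
  case: i => [|[|i]]/=.
  - by rewrite addn0 binn mulr0 addr0.
  - by rewrite addn1 binSn prednK// add0r mulr1.
  - rewrite nth_default ?mul0rn ?mulr0 ?addr0// pn !addnS ltnS.
    by rewrite -addSn prednK// leq_addr.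
have pn0 := coef_size_neq0 _ _ pn.
rewrite hornerD hornerC hornerZ hornerX /center -[p`_n *+ n]mulr_natl.
rewrite mulrN (mulrC (_ * p`_n)) divfK ?subrr ?scale0r//.
by rewrite mulf_neq0// pnatr_eq0 -lt0n.
Qed.

(** The factorials match: [Q] brings [n ^_ j], the divided derivative of [p] brings [(n - j)!], and
    their product is [n!]. For [j > n] both sides are 0 by the cut-offs in [derivn_sub] and
    [shift_family]. *)
Lemma shift_family_quotient {R : realType} (theta : R) (p : {poly R[i]})
    (n j : nat) (c l d : R[i]) :
  (Q theta n)^`(j).[l] / (n`!%:R * d) * (derivn_sub p n j).[c] =
  (shift_family theta p n c j).[l] / d.
Proof.
rewrite /derivn_sub /shift_family; case: leqP => le_jn; last first.
  by rewrite !horner0 mulr0 mul0r.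
have nf0 : n`!%:R != 0 :> R[i] by rewrite pnatr_eq0 -lt0n fact_gt0.
have mn : n`!%:R = (n ^_ j)%:R * (n - j)`!%:R :> R[i].
  by rewrite -natrM ffact_fact.
rewrite derivn_Q// nderivn_def !hornerMn hornerZ invfM.
rewrite -[_ *+ n ^_ j]mulr_natr -[_ *+ (n - j)`!]mulr_natr.
rewrite mn in nf0 *; have [->|d0] := eqVneq d 0.
  by rewrite invr0 !(mulr0, mul0r).
move: nf0; rewrite mulf_eq0 negb_or => /andP[f0 g0].
by field; rewrite d0 f0 g0.
Qed.

Lemma mu_expansionE {R : realType} (theta : R) (p : {poly R[i]}) (n k : nat)
    (h : R[i]) (c := center p n) (l := (lambda theta n k)%:C)
    (B := shift_family theta p n c) (d := (B 0%N)^`().[l]) : h != 0 ->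
  size p = n.+1 ->
  mu_expansion theta p n k h = c + h * (l - h^-1 ^+ 2 * ((B 2).[l] / d)
     - h^-1 ^+ 3 * ((B 3).[l] / d)).
Proof.
move=> h0 pn; have pn0 := coef_size_neq0 _ _ pn.
rewrite /mu_expansion -/(center p n) -/c -/l !mulrA !shift_family_quotient.
rewrite /d /B shift_family0 ?pn// derivZ hornerZ -/B.
rewrite !(invfM p`_n (_^`().[_])); set q := _^`().[l]^-1.
by field; rewrite h0 pn0.
Qed.

(** * Degree and zeros of [Delta], and the expansion *)

(** An affine change of variable keeps the size. [B_0] has degree [nroots theta n], [B_1 = 0], and
    each later [B_i] is zero or of degree at most [n - 2], which is smaller even when
    [theta = 0]. *)
Lemma size_Delta {R : realType} (theta : R) (h : R[i]) (p : {poly R[i]})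
    (n : nat) : 0 <= theta < pi -> (0 < n)%N -> size p = n.+1 -> h != 0 ->
  size (Delta theta h p) = (nroots theta n).+1.
Proof.
move=> ht n0 pn h0; pose c := center p n.
have pn0 := coef_size_neq0 _ _ pn.
have sX : size (c%:P + h *: 'X) = 2.
  by rewrite addrC -mul_polyC size_MXaddC polyC_eq0 size_polyC (negPf h0).
rewrite -(size_comp_poly2 _ sX) (Delta_family _ _ _ _ n)// ?pn//.
rewrite size_scale ?expf_neq0// big_ord_recl expr0 scale1r.
have sQ : size (p`_n *: Q theta n) = (nroots theta n).+1.
  by rewrite size_scale// size_Q.
rewrite shift_family0 ?pn// size_polyDl sQ//.
rewrite big_ord_recl /= shift_family1// scaler0 add0r.
apply: leq_ltn_trans (size_sum _ _ _) _.
rewrite ltnS; apply/bigmax_leqP => i _.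
apply: leq_trans (size_scale_leq _ _) _; rewrite /shift_family.
case: ifP => le_in; last by rewrite size_poly0.
apply: leq_trans (size_scale_leq _ _) _; apply: leq_trans (size_Q_le _ _) _.
rewrite -subSn// subSS (@leq_trans n.-1)//.
  by rewrite -subn1 leq_sub2l.
by rewrite /nroots; case: ifP => _; rewrite ?leq_pred.
Qed.

Lemma near_cinfty_inv {R : realType} (r : R[i]) : 0 < r ->
  \forall h \near cinfty R, h != 0 /\ `|h^-1| <= r.
Proof.
move=> r0; exists (complex.Re r^-1) => h.
rewrite RRe_real ?realV ?gtr0_real// => rh.
have h0 : 0 < `|h| by apply: lt_trans rh; rewrite invr_gt0.
split; first by rewrite -normr_gt0.
by rewrite normfV invf_ple ?posrE// ltW.
Qed.

Lemma Delta_root {R : realType} (theta : R) (h : R[i]) (p : {poly R[i]})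
    (n : nat) (c x : R[i]) : h != 0 -> (size p <= n.+1)%N ->
  root (\sum_(i < n.+4) h^-1 ^+ i *: shift_family theta p n c i) x ->
  root (Delta theta h p) (c + h * x).
Proof.
move=> h0 pn /rootP rx; apply/rootP.
have -> : c + h * x = (c%:P + h *: 'X).[x].
  by rewrite hornerD hornerC hornerZ hornerX.
by rewrite -horner_comp (Delta_family _ _ _ _ n)// hornerZ rx mulr0.
Qed.

Lemma eqp_prod_XsubC {F : fieldType} (p : {poly F}) (m : nat)
    (x : 'I_m -> F) : size p = m.+1 -> (forall i, root p (x i)) ->
  injective x -> p %= \prod_(i < m) ('X - (x i)%:P).
Proof.
move=> pm rx xi; have p0 : p != 0 by rewrite -size_poly_eq0 pm.
have -> : p = lead_coef p *: \prod_(y <- map x (enum 'I_m)) ('X - y%:P).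
  apply: all_roots_prod_XsubC; first by rewrite size_map size_enum_ord.
  - by apply/allP => _ /mapP[i _ ->].
  - by rewrite uniq_rootsE map_inj_uniq ?enum_uniq.
by rewrite big_map big_enum eqp_scale ?lead_coef_eq0.
Qed.

Theorem theorem1p12 (R : realType) (theta : R) (n : nat) (p : {poly R[i]})
  (htheta : 0 <= theta < pi) (hn : (1 <= n)%N) (hp : size p = n.+1) :
  exists mu : 'I_(nroots theta n) -> R[i] -> R[i],
    (\forall h \near cinfty R,
       Delta theta h p %= \prod_(k < nroots theta n) ('X - (mu k h)%:P)) /\
    (forall k : 'I_(nroots theta n),
       (mu k : R[i] -> (R[i])^o) = mu_expansion theta p n k.+1
         +O_ (cinfty R) (fun h : R[i] => h ^- 3 : (R[i])^o)).
Proof.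
have pn0 := coef_size_neq0 _ _ hp.
pose c := center p n; pose B := shift_family theta p n c.
pose l (k : 'I_(nroots theta n)) := (lambda theta n k.+1)%:C.
have B0E : B 0%N = p`_n *: Q theta n by rewrite /B shift_family0 ?hp.
have rootB k : root (B 0%N) (l k).
  by rewrite B0E rootZ//; apply: root_Q_lambda.
have dB k : (B 0%N)^`().[l k] != 0.
  by rewrite B0E derivZ hornerZ mulf_neq0//; apply: deriv_Q_lambda_neq0.
have B1 : B 1%N = 0 by exact: shift_family1.
(* Choosing [x k] as a function of [e = 1 / h] fixes one labelling for all [h] at once. *)
have /choice[x xP] k := perturbed_root B n (l k) (rootB k) (dB k) B1.
have {}xP k : exists M, 0 <= M /\ \forall h \near cinfty R, h != 0 /\
    [/\ root (\sum_(i < n.+4) h^-1 ^+ i *: B i) (x k h^-1),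
        `|c + h * x k h^-1 - mu_expansion theta p n k.+1 h| <= M * `|h ^- 3|
      & `|x k h^-1 - l k| <= M * `|h^-1|].
  have [M [r [M0 r0 H]]] := xP k; exists M; split=> //.
  near=> h.
  have [h0 hr] : h != 0 /\ `|h^-1| <= r by near: h; exact: near_cinfty_inv.
  have [rx xe xl] := H _ hr; split=> //; split=> //.
  rewrite mu_expansionE// -/c -/B -/(l k).
  rewrite opprD addrACA subrr add0r -mulrBr normrM.
  (* Undoing the scaling multiplies the error by [|h|]: order [h^-4] becomes [h^-3]. *)
  rewrite -ler_pdivlMl ?normr_gt0//; apply: le_trans xe _.
  by rewrite -exprVn normrX exprS mulrCA -normfV.
exists (fun k h => c + h * x k h^-1); split; last first.
  move=> k; apply/eqaddOP; have [M [M0 H]] := xP k.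
  near=> K; have MK : M <= K.
    by near: K; apply: nbhs_pinfty_ge; rewrite ger0_real.
  by apply: filterS H => h [h0 [_ xe _]]; apply: le_trans xe (ler_wpM2r _ MK).
have sep k j : k != j -> \forall h \near cinfty R, x k h^-1 != x j h^-1.
  move=> kj; have [M [M0 H]] := xP k; have [M' [M0' H']] := xP j.
  have lkj : 0 < `|l k - l j|.
    rewrite normr_gt0 subr_eq0; apply: contra_neq kj => -[] E.
    apply: val_inj.
    exact: (lambda_inj theta n _ _ htheta (ltn_ord k) (ltn_ord j) E).
  (* If the two zeros agreed, [|l k - l j|] would be at most [(M + M') |1/h|]; the extra [+ 1] makes
     this strictly less than [|l k - l j|] and the divisor positive. *)
  pose e := `|l k - l j| / (M + M' + 1).
  have MM : 0 < M + M' + 1 by rewrite ltr_pwDr// addr_ge0.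
  have e0 : 0 < e by rewrite divr_gt0.
  apply: filterS3 H H' (near_cinfty_inv _ e0).
  move=> h [_ [_ _ xl]] [_ [_ _ xl']] [h0 he].
  apply/eqP => xx; suff : `|l k - l j| < `|l k - l j| by rewrite ltxx.
  rewrite [X in `|X| < _](_ : _ = (x j h^-1 - l j) - (x k h^-1 - l k)); last first.
    by rewrite xx; ring.
  apply: le_lt_trans (ler_normB _ _) _.
  apply: le_lt_trans (lerD xl' xl) _.
  rewrite -mulrDl (addrC M') -[ltRHS](divfK (lt0r_neq0 MM)) -/e mulrC.
  apply: le_lt_trans (ler_wpM2r _ he) _; first exact: addr_ge0.
  by rewrite ltr_pM2l// ltrDl.
have hsep : \forall h \near cinfty R,
    forall k j, k != j -> x k h^-1 != x j h^-1.
  (* There are finitely many pairs, so one threshold serves them all. *)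
  apply: filter_forall => k; apply: filter_forall => j.
  have [->|kj] := eqVneq k j; first by near=> h.
  by apply: filterS (sep _ _ kj) => h.
have hroots : \forall h \near cinfty R, forall k,
    h != 0 /\ root (\sum_(i < n.+4) h^-1 ^+ i *: B i) (x k h^-1).
  apply: filter_forall => k; have [M [M0 H]] := xP k.
  by apply: filterS H => h [h0 []].
apply: filterS3 hsep hroots (near_cinfty_inv 1 ltr01) => h hs hr [h0 _].
(* The zeros found are distinct and as many as the degree, so none is missing. *)
apply: eqp_prod_XsubC; first exact: size_Delta.
- move=> k; have [_ rx] := hr k.
  by apply: (Delta_root _ _ _ n); rewrite ?hp.
- move=> k j /addrI/(mulfI h0) E; apply/eqP/negP => /negP kj.
  by have := hs _ _ kj; rewrite E eqxx.
Unshelve. all: by end_near. Qed.
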